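(* Let $f:\mathbb{R}_{\ge0}\to\mathbb{R}_{\ge0}$ be any function and let $\mu<17/16$. Then there exists an instance such that no incremental solution $\pi$ satisfies $\mu\,p(\pi(B+f(\gamma)))\ge p(\textsc{Opt}(B))$ for all $B\in\mathbb{R}_{\ge0}$, where $\gamma$ is the maximum cost of a simple path in $G$ starting at $r$. Equivalently, every $(\alpha,\mu)$-competitive algorithm in which the additive slack $\alpha$ depends only on $\gamma$ has $\mu\ge 17/16$.
   Context: An instance consists of a finite undirected graph $G=(V,E)$, edge costs $c(e)>0$, vertex prizes $p(v)\ge0$ and a root $r\in V$. For a subgraph $G'=(V',E')$, $p(G')=\sum_{v\in V'}p(v)$ and $c(G')=\sum_{e\in E'}c(e)$. A rooted subtree is a subtree of $G$ containing $r$. For $B\ge0$, $\textsc{Opt}(B)$ is a rooted subtree maximizing $p(T)$ subject to $c(T)\le B$. Let $V^*=\{v:p(v)>0\}$. An incremental solution is a sequence $\pi=(e_1,\dots,e_l)$ of distinct edges such that every prefix, together with $r$, forms a rooted subtree and the whole sequence spans $V^*$; for $B\ge0$, $\pi(B)$ is the rooted subtree formed by $r$ and the edges $e_i$ with $\sum_{j\le i}c(e_j)\le B$. An algorithm is $(\alpha,\mu)$-competitive if for every instance its output $\pi$ satisfies $\mu\,p(\pi(B+\alpha))\ge p(\textsc{Opt}(B))$ for all $B\ge0$. *)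

(* Defs.v *)
From HB Require Import structures.
From mathcomp Require Import all_boot all_order all_algebra.
From mathcomp Require Import boolp reals.

Set Implicit Arguments.
Unset Strict Implicit.
Unset Printing Implicit Defensive.

Import Order.TTheory GRing.Theory Num.Theory.
Local Open Scope ring_scope.

(** Edges are two-element sets of vertices, so graphs are simple.
    Connectedness is what makes the requirement that a solution span all
    positive-prize vertices satisfiable; without it an instance could fail to
    have any incremental solution at all.  Values of [ecost] outside [edges]
    are irrelevant. *)
Record instance (R : realType) := Instance {
  vertex :> finType;
  edges : {set {set vertex}};
  ecost : {set vertex} -> R;
  vprize : vertex -> R;
  root : vertex;
  edges_card2 : forall e, e \in edges -> #|e| = 2;
  ecost_gt0 : forall e, e \in edges -> 0 < ecost e;
  vprize_ge0 : forall v, 0 <= vprize v;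
  graph_connected :
    forall x y, connect [rel x y | [set x; y] \in edges] x y
}.

Section Definitions.
Variables (R : realType) (I : instance R).

(** A pair (vertex set, edge set). *)
Definition subgraph : Type := ({set I} * {set {set I}})%type.

Definition prize (T : subgraph) : R := \sum_(v in T.1) vprize v.
Definition cost (T : subgraph) : R := \sum_(e in T.2) ecost e.

Definition adj (F : {set {set I}}) : rel I := [rel x y | [set x; y] \in F].

Definition is_subgraph (T : subgraph) : Prop :=
  T.2 \subset edges I /\ (forall e, e \in T.2 -> e \subset T.1).

Definition connected_graph (T : subgraph) : Prop :=
  forall x y, x \in T.1 -> y \in T.1 -> connect (adj T.2) x y.

(** [cycle] also accepts the sequence [:: x; y], which traverses one edge back
    and forth; genuine cycles of a simple graph have at least three vertices. *)
Definition acyclic_graph (T : subgraph) : Prop :=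
  forall c : seq I, cycle (adj T.2) c -> uniq c -> (size c <= 2)%N.

Definition rooted_subtree (T : subgraph) : Prop :=
  [/\ is_subgraph T, connected_graph T, acyclic_graph T & root I \in T.1].

(** [is_opt B T]: T is an admissible choice of Opt(B). *)
Definition is_opt (B : R) (T : subgraph) : Prop :=
  [/\ rooted_subtree T, cost T <= B &
      forall T', rooted_subtree T' -> cost T' <= B -> prize T' <= prize T].

(** The subgraph formed by the root and a set of edges. *)
Definition graph_of_edges (F : {set {set I}}) : subgraph :=
  (root I |: cover F, F).

Definition positive_vertices : {set I} := [set v | 0 < vprize v].

Definition incremental (pi : seq {set I}) : Prop :=
  [/\ uniq pi,
      forall k, rooted_subtree (graph_of_edges [set e in take k pi]) &
      positive_vertices \subset (graph_of_edges [set e in pi]).1].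

(** pi(B); the edges of an incremental solution being distinct, [index e pi] is
    the position of e in pi. *)
Definition within_budget (pi : seq {set I}) (B : R) : subgraph :=
  graph_of_edges
    [set e in pi | \sum_(e' <- take (index e pi).+1 pi) ecost e' <= B].

(** A path starting at the root is given by the sequence of its subsequent
    vertices. *)
Definition simple_root_path (p : seq I) : bool :=
  path (adj (edges I)) (root I) p && uniq (root I :: p).

Definition path_cost (p : seq I) : R :=
  \sum_(e <- pairmap (fun x y => [set x; y]) (root I) p) ecost e.

(** A simple path has fewer than #|I| edges; the default value 0 is the cost of
    the one-vertex path.  See [gamma_max]. *)
Definition gamma : R :=
  \big[Num.max/0]_(n < #|I|)
    \big[Num.max/0]_(p : n.-tuple I | simple_root_path p) path_cost p.

Definition competitive_solution (alpha mu : R) (pi : seq {set I}) : Prop :=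
  forall B : R, 0 <= B -> forall T : subgraph, is_opt B T ->
    mu * prize (within_budget pi (B + alpha)) >= prize T.

Lemma rooted_subtree_root : rooted_subtree ([set root I], set0).
Proof.
split=> /=.
- by split=> [|e]; rewrite /= ?sub0set ?inE.
- by move=> x y /set1P-> /set1P->; apply: connect0.
- by case=> [|x [|y c]] //=; rewrite /adj /= in_set0.
- by rewrite set11.
Qed.

Lemma opt_exists (B : R) : 0 <= B -> exists T, is_opt B T.
Proof.
move=> B0; pose P (T : subgraph) := `[< rooted_subtree T /\ cost T <= B >].
have P0 : P ([set root I], set0).
  apply/asboolP; split; first exact: rooted_subtree_root.
  by rewrite /cost big_set0.
have [T /asboolP[tT cT] maxT] :=
  Order.TotalTheory.arg_maxP (fun T : subgraph => prize T) P0.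
by exists T; split=> // T' tT' cT'; apply: maxT; apply/asboolP.
Qed.

Lemma gamma_max :
  (exists2 p, simple_root_path p & path_cost p = gamma) /\
  (forall p, simple_root_path p -> path_cost p <= gamma).
Proof.
split.
- rewrite /gamma.
  have nilP : exists2 p, simple_root_path p & path_cost p = 0.
    by exists [::] => //; rewrite /path_cost big_nil.
  have maxP (x y : R) : (exists2 p, simple_root_path p & path_cost p = x) ->
      (exists2 p, simple_root_path p & path_cost p = y) ->
      exists2 p, simple_root_path p & path_cost p = Num.max x y.
    by move=> hx hy; case: leP.
  elim/big_ind: _ => // n _; elim/big_ind: _ => // p sp.
  by exists p.
- move=> p sp.
  have lt_p : (size p < #|I|)%N.
    have /andP[_ /card_uniqP eqp] := sp.
    by move: (max_card (mem (root I :: p))); rewrite [leqLHS]eqp.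
  rewrite /gamma (bigD1 (Ordinal lt_p)) //= le_max.
  by rewrite (bigD1 (in_tuple p)) //= le_max lexx.
Qed.

End Definitions.

(** No computability or running-time restriction is imposed. *)
Definition algorithm (R : realType) : Type :=
  forall I : instance R, {s : seq {set I} | incremental s}.

Definition competitive (R : realType) (alpha : instance R -> R) (mu : R)
    (A : algorithm R) : Prop :=
  forall I : instance R, competitive_solution (alpha I) mu (sval (A I)).

(* Main.v *)
(** Glue [n] copies ("petals") of a four-cycle [r, v1, v2, a] at the root [r];
    [r a] costs 2, the other edges cost 1, and the prizes are 1, 1, 8.  The
    longest simple path costs 4 whatever [n] is, so the additive slack is
    constant while the interesting budgets grow with [n].  With budget [2n] it
    is best to buy all edges [r a] (prize [8n]), with budget [3n] all paths
    [r, v1, v2, a] (prize [10n]); but a petal in which [r a] was bought early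
    still needs cost 4 for the full prize, while the path is a poor way of
    reaching [a] early.  For the states of an incremental solution at the two
    budgets this gives 3 p + 4 p' <= 10 c + 4 c' + 28 in each petal, hence
    3 P + 4 P' <= 60 n + O(1), against 3 (8 n) + 4 (10 n) = 64 n.  The
    competitive ratio is therefore at least 64/60 - o(1) > 17/16. *)
Require Import Defs.
From mathcomp Require Import all_boot all_order all_algebra.
From mathcomp Require Import reals.
From mathcomp Require Import lra.

Import Order.TTheory GRing.Theory Num.Theory.
Local Open Scope ring_scope.

(** * Subtrees, cuts and budget prefixes in an arbitrary instance *)

Lemma set2_inj {T : finType} {a b c d : T} :
  [set a; b] = [set c; d] -> a = c /\ b = d \/ a = d /\ b = c.
Proof.
move=> eq_ab.
have /set2P ha : a \in [set c; d] by rewrite -eq_ab set21.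
have /set2P hb : b \in [set c; d] by rewrite -eq_ab set22.
have /set2P hc : c \in [set a; b] by rewrite eq_ab set21.
have /set2P hd : d \in [set a; b] by rewrite eq_ab set22.
clear eq_ab; intuition congruence.
Qed.

Lemma adj_sym {R : realType} {I : instance R} (F : {set {set I}}) :
  symmetric (adj F).
Proof. by move=> x y; rewrite /adj /= setUC. Qed.

Lemma connected_to_root {R : realType} {I : instance R} (T : subgraph I) :
  (forall x, x \in T.1 -> connect (adj T.2) (Defs.root I) x) ->
  connected_graph T.
Proof.
move=> conn x y xT yT; apply: connect_trans (conn y yT).
by rewrite (sym_connect_sym (adj_sym _)) conn.
Qed.

(* A deepest vertex of a cycle would have two such neighbours. *)
Lemma acyclic_depth {R : realType} {I : instance R} (T : subgraph I)
    (d : I -> nat) :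
  (forall x y z, adj T.2 x y -> adj T.2 x z ->
     (d y <= d x)%N -> (d z <= d x)%N -> y = z) ->
  acyclic_graph T.
Proof.
move=> one_low c cyc_c uniq_c; rewrite leqNgt; apply/negP=> c_gt2.
case: c => [|x0 c0] in cyc_c uniq_c c_gt2 *; first by [].
have x0P : (mem (x0 :: c0)) x0 by rewrite /= mem_head.
case: (arg_maxnP d x0P) => x xc max_x.
(* Rotate the cycle to start at its deepest vertex [x]; the two neighbours of [x] are then the next
   vertex [y] and the last vertex [z]. *)
have [i s eq_s] := rot_to xc.
have mem_s y : y \in x :: s -> (d y <= d x)%N.
  by rewrite -eq_s mem_rot => /max_x.
move: cyc_c uniq_c c_gt2.
rewrite -(rot_cycle i) -(rot_uniq i) -(size_rot i) eq_s.
case: s mem_s {eq_s} => [|y s] //; case/lastP: s => [|s z] // mem_s.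
rewrite /= rcons_path => /andP[xy /andP[_ zx]].
rewrite last_rcons adj_sym in zx.
have -> : y = z.
  by apply: (one_low x) => //; apply: mem_s; rewrite !inE ?mem_rcons ?inE eqxx ?orbT.
by rewrite mem_rcons inE eqxx andbF.
Qed.

(** If no edge of [T] crossed [X], then [X] would be closed under adjacency, and connectivity would
    carry membership from [u] to the root. *)
Lemma cut_edge {R : realType} {I : instance R} {T : subgraph I} (X : pred I)
    {u : I} :
  rooted_subtree T -> u \in T.1 -> X u -> ~~ X (Defs.root I) ->
  exists x y, [/\ X x, ~~ X y & [set x; y] \in T.2].
Proof.
case=> _ conn _ rT uT Xu Xr.
case: (boolP [exists x, exists y, [&& X x, ~~ X y & [set x; y] \in T.2]]).
  by case/existsP=> x /existsP[y /and3P[]]; exists x, y.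
move/existsPn=> no_cut.
have clX : closed (adj T.2) X.
  apply: (intro_closed (sym_connect_sym (adj_sym _))) => x y xy Xx.
  have /existsPn/(_ y) := no_cut x.
  by rewrite (_ : X x) //= -[_ \in T.2]/(adj T.2 x y) xy andbT negbK.
have := closed_connect clX (conn _ _ uT rT).
by rewrite !unfold_in Xu (negPf Xr).
Qed.

(** Nonnegative weights make partial sums monotone, so the elements whose partial sum fits in [B]
    form the longest prefix that fits. *)
Lemma budget_prefix {R : realType} {T : eqType} (w : T -> R) (s : seq T)
    (B : R) :
  (forall e, e \in s -> 0 <= w e) -> 0 <= B ->
  exists2 k, \sum_(e <- take k s) w e <= B &
    forall e, (e \in take k s) =
      (e \in s) && (\sum_(e' <- take (index e s).+1 s) w e' <= B).
Proof.
move=> w_ge0 B_ge0; pose psum k := \sum_(e <- take k s) w e.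
have le_psum j k : (j <= k)%N -> psum j <= psum k.
  move=> le_jk; rewrite /psum -(cat_take_drop j (take k s)) take_takel //.
  rewrite big_cat /= lerDl big_seq sumr_ge0 // => e /mem_drop /mem_take.
  exact: w_ge0.
pose P k := (k <= size s)%N && (psum k <= B).
have exP : exists k, P k by exists 0%N; rewrite /P /psum take0 big_nil.
have maxP k : P k -> (k <= size s)%N by case/andP.
case: (ex_maxnP exP maxP) => k /andP[le_k psum_k] max_k.
exists k => // e; case: (boolP (e \in s)) => [es|]; last first.
  by apply: contraNF => /mem_take.
rewrite in_take //; apply/idP/idP => [lt_ek|le_eB].
  exact: le_trans (le_psum _ _ lt_ek) psum_k.
by apply: max_k; rewrite /P index_mem es.
Qed.

Lemma within_budget_subset {R : realType} {I : instance R} (pi : seq {set I})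
    (B B' : R) :
  B <= B' -> (within_budget pi B).2 \subset (within_budget pi B').2.
Proof.
move=> le_BB'; apply/subsetP=> e; rewrite !inE => /andP[-> /=].
by move/le_trans; apply.
Qed.

(** The edges within the budget form a prefix of [pi], to which [incremental] applies; distinctness
    turns the sum along the prefix into the cost of its edge set. *)
Lemma within_budget_rooted {R : realType} {I : instance R} (pi : seq {set I})
    (B : R) :
  incremental pi -> 0 <= B ->
  rooted_subtree (within_budget pi B) /\ cost (within_budget pi B) <= B.
Proof.
case=> uniq_pi prefix_tree _ B_ge0.
have pi_ge0 e : e \in pi -> 0 <= ecost e.
  case: (prefix_tree (size pi)) => -[/subsetP sub_E _] _ _ _ e_pi.
  by apply/ltW/ecost_gt0/sub_E; rewrite inE take_size.
have [k le_kB mem_k] := budget_prefix (@ecost R I) pi B pi_ge0 B_ge0.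
have -> : within_budget pi B = graph_of_edges [set e in take k pi].
  by congr graph_of_edges; apply/setP=> e; rewrite !inE mem_k.
split; first exact: prefix_tree.
rewrite /cost (eq_bigl (mem (take k pi))) => [|e]; last by rewrite !inE.
by rewrite -big_uniq ?take_uniq.
Qed.

(** * The flower graph *)

(* In the [i]-th petal, [v1], [v2], [a] are [Some (i, Some false)],
   [Some (i, Some true)] and [Some (i, None)].  Edge [(i, k)] is the [k]-th one
   along the cycle [r, v1, v2, a], with [k] read as a binary number, so that
   [(true, true)] is the edge [a r] of cost 2. *)
Definition flower_vertex (n : nat) : finType := option ('I_n * option bool).

Definition source {n : nat} (j : 'I_n * (bool * bool)) : flower_vertex n :=
  match j.2 with
  | (false, false) => None
  | (false, true) => Some (j.1, Some false)
  | (true, false) => Some (j.1, Some true)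
  | (true, true) => Some (j.1, None)
  end.

Definition target {n : nat} (j : 'I_n * (bool * bool)) : flower_vertex n :=
  match j.2 with
  | (false, false) => Some (j.1, Some false)
  | (false, true) => Some (j.1, Some true)
  | (true, false) => Some (j.1, None)
  | (true, true) => None
  end.

Definition petal_edge {n : nat} (j : 'I_n * (bool * bool)) :
    {set flower_vertex n} := [set source j; target j].

(** [D] selects the same edges in every petal: [predT] gives the whole graph, [pred1 (true, true)]
    and [predC1 (true, true)] the two trees that bound the optima from below. *)
Definition petal_edges (n : nat) (D : pred (bool * bool)) :
    {set {set flower_vertex n}} := petal_edge @: [set j | D j.2].

(** Costs are a function of the vertex set, so the edge of cost 2 is recognised by containing both
    the root and some [a]. *)
Definition flower_cost {n : nat} (e : {set flower_vertex n}) : nat :=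
  if (None \in e) && [exists i, Some (i, None) \in e] then 2%N else 1%N.

Definition flower_prize {n : nat} (v : flower_vertex n) : nat :=
  match v with
  | None => 0%N
  | Some (_, None) => 8%N
  | Some (_, Some _) => 1%N
  end.

Lemma petal_edge_inj (n : nat) : injective (@petal_edge n).
Proof.
move=> [i [b c]] [i' [b' c']] /set2_inj.
by case: b c b' c' => [] [] [] []; rewrite /source /target /= => -[] [] *; congruence.
Qed.

Lemma mem_petal_edges (n : nat) (D : pred (bool * bool)) i k :
  (petal_edge (i, k) \in petal_edges n D) = D k.
Proof. by rewrite mem_imset ?inE //; apply: petal_edge_inj. Qed.

Lemma petal_edgesP (n : nat) (D : pred (bool * bool)) x y :
  [set x; y] \in petal_edges n D ->
  exists2 j, D j.2 &
    x = source j /\ y = target j \/ x = target j /\ y = source j.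
Proof. by case/imsetP=> j; rewrite inE => Dj /set2_inj eq_xy; exists j. Qed.

Lemma flower_costE (n : nat) (i : 'I_n) k :
  flower_cost (petal_edge (i, k)) = (if k.1 && k.2 then 2 else 1)%N.
Proof.
rewrite /flower_cost (_ : (None \in _) = (k.1 == k.2)); last first.
  by rewrite !inE; case: k => -[] [].
rewrite (_ : [exists _, _] = k.1); first by case: k => -[] [].
case: k => -[] b /=; last first.
  by apply/negbTE/existsP=> -[i' /set2P]; case: b => -[].
by apply/existsP; exists i; rewrite !inE; case: b; rewrite eqxx ?orbT.
Qed.

Lemma flower_path_connect (n : nat) (F : {set {set flower_vertex n}}) x :
  petal_edges n (predC1 (true, true)) \subset F ->
  connect [rel x y | [set x; y] \in F] None x.
Proof.
move/subsetP=> sub_F.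
have step i k : k != (true, true) ->
    connect [rel x y | [set x; y] \in F] (source (i, k)) (target (i, k)).
  by move=> kP; apply/connect1/sub_F; rewrite mem_petal_edges.
case: x => [[i c]|] //.
have c1 := step i (false, false) isT.
have c2 := connect_trans c1 (step i (false, true) isT).
have c3 := connect_trans c2 (step i (true, false) isT).
by case: c => [[]|].
Qed.

Lemma flower_card2 (n : nat) e : e \in petal_edges n predT -> #|e| = 2.
Proof.
by case/imsetP=> -[i [[] []]] _ ->; rewrite /petal_edge cards2; case: eqP.
Qed.

Lemma flower_connected (n : nat) (x y : flower_vertex n) :
  connect [rel x y | [set x; y] \in petal_edges n predT] x y.
Proof.
have conn v : connect [rel x y | [set x; y] \in petal_edges n predT] None v.
  apply: flower_path_connect; apply/subsetP=> e /imsetP[j _ ->].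
  by apply: imset_f; rewrite inE.
apply: connect_trans (conn y); rewrite sym_connect_sym ?conn //.
by move=> u v /=; rewrite setUC.
Qed.

Definition flower (R : realType) (n : nat) : instance R.
Proof.
refine (@Instance R (flower_vertex n) (petal_edges n predT)
  (fun e => (flower_cost e)%:R) (fun v => (flower_prize v)%:R) None
  (@flower_card2 n) _ _ (@flower_connected n)).
- by move=> e _; rewrite /flower_cost; case: ifP.
- by move=> v; apply: ler0n.
Defined.

(** * Simple paths from the root of the flower *)

Lemma petal_step (n : nat) i c (y : flower_vertex n) :
  [set Some (i, c); y] \in petal_edges n predT -> y != None ->
  exists c', y = Some (i, c').
Proof.
case/petal_edgesP=> -[i' [b1 b2]] _; rewrite /source /target.
by case: b1 b2 => [] [] [[]|[]] //= [-> _] -> // _; eexists.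
Qed.

(** Petals meet only at the root, so after its first edge a simple path stays among the three other
    vertices of one petal: at most 2 for the first edge, then at most two edges of cost 1. *)
Lemma flower_simple_path (R : realType) (n : nat) (p : seq (flower R n)) :
  simple_root_path p -> path_cost p <= 4%:R.
Proof.
case: p => [|x q]; first by rewrite /path_cost big_nil ler0n.
rewrite /simple_root_path => /andP[/= /andP[rx path_q]].
rewrite inE => /andP[/norP[x_root q_root] uniq_q].
have [i [c eq_x]] : exists i c, x = Some (i, c).
  by case: x x_root {rx path_q q_root uniq_q} => [[i c]|] // _; exists i, c.
have [in_petal cost_q] : {subset x :: q <= [seq Some (i, c) | c : option bool]}
    /\ (\sum_(e <- pairmap (fun x y => [set x; y]) x q) flower_cost e = size q)%N.
  have mem_petal c' : Some (i, c') \in [seq Some (i, c) | c : option bool].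
    exact: image_f.
  elim: q x c eq_x {x_root rx uniq_q} path_q q_root => [|y q IHq] x c eq_x /=.
    by move=> _ _; rewrite big_nil; split=> // z; rewrite inE eq_x => /eqP->.
  case/andP=> xy path_q; rewrite inE => /norP[y_root q_root].
  move: xy; rewrite eq_x => xy.
  have [|c' eq_y] := petal_step _ _ _ _ xy; first by rewrite eq_sym.
  have [IHmem IHcost] := IHq _ _ eq_y path_q q_root.
  split=> [z|].
    by rewrite inE => /predU1P[->|/IHmem].
  by rewrite big_cons IHcost /flower_cost eq_y !inE.
have := uniq_leq_size _ in_petal; rewrite size_image card_option card_bool /=.
move=> /(_ uniq_q) size_q.
rewrite /path_cost /= big_cons -natr_sum cost_q -natrD ler_nat.
apply: (@leq_add _ _ 2%N 2%N) size_q.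
by rewrite /flower_cost; case: ifP.
Qed.

Lemma flower_gamma (R : realType) (n : nat) : gamma (flower R n.+1) = 4%:R.
Proof.
have [[p simple_p eq_p] max_path] := gamma_max (flower R n.+1).
apply/le_anti; rewrite -{1}eq_p flower_simple_path //=.
pose v c : flower R n.+1 := Some (ord0, c).
have mem_edge k : petal_edge (ord0, k) \in petal_edges n.+1 predT.
  by rewrite mem_petal_edges.
have edgeC k : [set target (ord0 : 'I_n.+1, k); source (ord0, k)] \in petal_edges n.+1 predT.
  by rewrite setUC mem_edge.
(* Starting with the edge [r a] gives cost 2 + 1 + 1; the edges are traversed from [target] to
   [source]. *)
have simple_q : simple_root_path [:: v None; v (Some true); v (Some false)].
  rewrite /simple_root_path; apply/andP; split; last first.
    by [].
  rewrite /= andbT.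
  by rewrite /adj /= (edgeC (true, true)) (edgeC (true, false)) (edgeC (false, true)).
apply: le_trans (_ : path_cost [:: v None; v (Some true); v (Some false)] <= _).
  rewrite /path_cost !big_cons big_nil addr0.
  have costC k : ecost (i := flower R n.+1) [set target (ord0 : 'I_n.+1, k); source (ord0, k)] = (if k.1 && k.2 then 2 else 1)%N%:R.
    by rewrite setUC /= flower_costE.
  rewrite (costC (true, true)) (costC (true, false)) (costC (false, true)) /=.
  by rewrite -!natrD.
exact: max_path.
Qed.

(** * Cost and prize accounted petal by petal *)

Lemma sum_pair {I J : finType} (F : I * J -> nat) :
  (\sum_p F p = \sum_i \sum_j F (i, j))%N.
Proof. by rewrite pair_bigA; apply: eq_bigr => -[]. Qed.

Definition petal_cost (S : pred (bool * bool)) : nat :=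
  (S (false, false) + S (false, true) + S (true, false) + 2 * S (true, true))%N.

(** Each of [v1], [v2], [a] lies on two edges of its petal and counts as soon as one of them is in
    [S]. *)
Definition petal_prize (S : pred (bool * bool)) : nat :=
  ((S (false, false) || S (false, true)) + (S (false, true) || S (true, false))
   + 8 * (S (true, false) || S (true, true)))%N.

(** Cut conditions for the vertex sets [{v1, v2}], [{v2, a}] and [{v1, v2, a}]: an edge inside such
    a set forces an edge leaving it. *)
Definition petal_rooted (S : pred (bool * bool)) : bool :=
  [&& S (false, true) ==> S (false, false) || S (true, false),
      S (true, false) ==> S (false, true) || S (true, true) &
      S (false, true) || S (true, false) ==> S (false, false) || S (true, true)].

(* The coefficients form an optimal dual solution of the linear program for the
   best mixture of per-petal strategies; 3 and 10 belong to the smaller budget. *)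
Lemma petal_tradeoff (S S' : pred (bool * bool)) :
  petal_rooted S -> petal_rooted S' -> (forall k, S k -> S' k) ->
  (3 * petal_prize S + 4 * petal_prize S' <=
   10 * petal_cost S + 4 * petal_cost S' + 28)%N.
Proof.
rewrite /petal_rooted /petal_prize /petal_cost => rS rS' le_SS'.
move: (le_SS' (false, false)) (le_SS' (false, true)).
move: (le_SS' (true, false)) (le_SS' (true, true)) rS rS'.
case: (S (false, false)); case: (S (false, true)); case: (S (true, false));
case: (S (true, true)); case: (S' (false, false)); case: (S' (false, true));
case: (S' (true, false)); case: (S' (true, true)) => //= h1 h2 rS rS' h3 h4;
  by [| move: (h1 isT) | move: (h2 isT) | move: (h3 isT) | move: (h4 isT)].
Qed.

Definition petal_trace {n : nat} (F : {set {set flower_vertex n}}) (i : 'I_n) :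
  pred (bool * bool) := fun k => petal_edge (i, k) \in F.

Lemma flower_cost_sum (R : realType) (n : nat) (T : subgraph (flower R n)) :
  T.2 \subset petal_edges n predT ->
  cost T = (\sum_i petal_cost (petal_trace T.2 i))%N%:R.
Proof.
move=> /subsetP sub_T; rewrite /cost -natr_sum; congr (_ %:R).
have eq_T : T.2 = petal_edge @: [set j | petal_edge j \in T.2].
  apply/setP=> e; apply/idP/imsetP=> [eT|[j]]; last by rewrite inE => jT ->.
  by have /imsetP[j _ eq_e] := sub_T e eT; exists j; rewrite ?inE -?eq_e.
rewrite {1}eq_T big_imset /=; last by move=> j j' _ _; apply: petal_edge_inj.
under eq_bigl do rewrite inE.
rewrite big_mkcond /= sum_pair; apply: eq_bigr => i _.
rewrite sum_pair !big_bool /=.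
rewrite !flower_costE /petal_cost /petal_trace /=.
by do 4!case: (_ \in T.2).
Qed.

Lemma flower_prize_sum (R : realType) (n : nat) (T : subgraph (flower R n)) :
  prize T = (\sum_(i < n) ((Some (i, Some false) \in T.1) +
    (Some (i, Some true) \in T.1) + 8 * (Some (i, None) \in T.1)))%N%:R.
Proof.
rewrite /prize -natr_sum; congr (_ %:R).
rewrite big_mkcond (bigD1 None) //= if_same add0n.
rewrite (reindex_omap Some id) => [|[]//] /=.
under eq_bigl do rewrite eqxx.
rewrite sum_pair; apply: eq_bigr => i _.
rewrite (bigD1 None) // (bigD1 (Some true)) // (bigD1 (Some false)) //=.
rewrite big1 => [|[[]|]//].
by do 3!case: (_ \in T.1).
Qed.

Lemma mem_graph_of_petals (R : realType) (n : nat)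
    (F : {set {set flower_vertex n}}) (v : flower_vertex n) :
  F \subset petal_edges n predT -> v != None ->
  v \in (graph_of_edges (I := flower R n) F).1 ->
  exists2 j, petal_edge j \in F & v = source j \/ v = target j.
Proof.
move=> /subsetP sub_F /negPf v_root; rewrite !inE v_root => /bigcupP[e eF].
by have /imsetP[j _ eq_e] := sub_F e eF; rewrite eq_e => /set2P; exists j; rewrite -?eq_e.
Qed.

Lemma prize_graph_of_petals (R : realType) (n : nat) (F : {set {set flower_vertex n}}) :
  F \subset petal_edges n predT ->
  prize (graph_of_edges (I := flower R n) F) <=
  (\sum_i petal_prize (petal_trace F i))%N%:R.
Proof.
move=> sub_F; rewrite flower_prize_sum ler_nat; apply: leq_sum => i _.
have memF c : Some (i, c) \in (graph_of_edges (I := flower R n) F).1 ->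
    match c with
    | Some false => petal_trace F i (false, false) || petal_trace F i (false, true)
    | Some true => petal_trace F i (false, true) || petal_trace F i (true, false)
    | None => petal_trace F i (true, false) || petal_trace F i (true, true)
    end.
  case/(mem_graph_of_petals R n F (Some (i, c)) sub_F isT) => -[i' [b1 b2]].
  rewrite /petal_trace /source /target.
  by case: b1 b2 => [] [] jF /= [] // [-> ->]; rewrite jF ?orbT.
have bool_le (b b' : bool) : (b -> b') -> (b <= b')%N.
  by case: b b' => [] [] // /(_ isT).
rewrite /petal_prize.
apply: leq_add; [apply: leq_add | rewrite leq_mul2l; apply/orP; right];
  apply: bool_le.
- exact: (memF (Some false)).
- exact: (memF (Some true)).
- exact: (memF None).
Qed.

Lemma petal_trace_rooted (R : realType) (n : nat)
    (F : {set {set flower_vertex n}}) (i : 'I_n) :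
  rooted_subtree (graph_of_edges (I := flower R n) F) ->
  petal_rooted (petal_trace F i).
Proof.
move=> treeF; have [[/subsetP sub_F subV] _ _ _] := treeF.
have endpoints k : petal_edge (i, k) \in F ->
    source (i, k) \in (graph_of_edges (I := flower R n) F).1 /\
    target (i, k) \in (graph_of_edges (I := flower R n) F).1.
  by move=> kF; have /subsetP sub_e := subV _ kF; split; apply: sub_e; rewrite !inE eqxx ?orbT.
(* As [X'] lies in petal [i] and misses the root, the crossing edge belongs to that petal; comparing
   [inX] at its endpoints leaves a finite check. *)
have cut (X : pred (option bool)) c :
    Some (i, c) \in (graph_of_edges (I := flower R n) F).1 -> X c ->
    exists b1 b2, petal_trace F i (b1, b2) /\
      (let inX v := if v is Some (_, c') then X c' else false in
       inX (source (i, (b1, b2))) != inX (target (i, (b1, b2)))).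
  move=> cV Xc.
  pose X' (v : flower R n) := if v is Some (i', c') then (i' == i) && X c' else false.
  have [||x [y [Xx Xy xyF]]] := cut_edge X' treeF cV; rewrite /X' ?eqxx //.
  have /imsetP[[i' [b1 b2]] _ eq_xy] := sub_F _ xyF.
  rewrite eq_xy in xyF; exists b1, b2; move: Xx Xy xyF.
  case: (set2_inj eq_xy) => -[-> ->]; rewrite /X' /source /target;
    case: b1 b2 {eq_xy} => [] [] //=; case/andP=> /eqP-> Xx;
    rewrite ?eqxx ?Xx //= => Xy jF; split=> //; rewrite ?(negPf Xy) //.
apply/and3P; split; apply/implyP.
- move=> /endpoints[v _].
  (* The cut at [{v1, v2}]; the other two conditions use [{v2, a}] and the whole petal. *)
  have [b1 [b2 []]] := cut (fun c => if c is Some _ then true else false) _ v isT.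
  by case: b1 b2 => [] [] //= ->; rewrite ?orbT.
- move=> /endpoints[v _].
  have [b1 [b2 []]] := cut (fun c => if c is Some false then false else true) _ v isT.
  by case: b1 b2 => [] [] //= ->; rewrite ?orbT.
- have all_cut c : Some (i, c) \in (graph_of_edges (I := flower R n) F).1 ->
      petal_trace F i (false, false) || petal_trace F i (true, true).
    move=> /(cut predT _)/(_ isT)[b1 [b2 []]].
    by case: b1 b2 => [] [] //= ->; rewrite ?orbT.
  by case/orP=> /endpoints[v _]; apply: all_cut v.
Qed.

(** * Trees bounding the optimum from below at the two budgets *)

Definition petal_depth {n : nat} (v : flower_vertex n) : nat :=
  match v with
  | None => 0%N
  | Some (_, Some false) => 1%N
  | Some (_, Some true) => 2%N
  | Some (_, None) => 3%N
  end.

(** Under [petal_depth], a vertex has at most one neighbour that is no deeper, unless [a] is joined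
    to both [v2] and the root; the hypothesis on [D] excludes this. *)
Lemma petal_edges_acyclic (R : realType) (n : nat) (D : pred (bool * bool))
    (V : {set flower_vertex n}) :
  (D (true, true) -> forall k, D k -> k = (true, true)) ->
  acyclic_graph (I := flower R n) (V, petal_edges n D).
Proof.
move=> only_tt; apply: (@acyclic_depth R (flower R n) _ petal_depth).
move=> x y z /petal_edgesP[[i k] /= Dk xy] /petal_edgesP[[i' k'] /= Dk' xz].
have sym : k = (true, true) -> k' = (true, true).
  by move=> eq_k; apply: only_tt Dk'; rewrite -eq_k.
have sym' : k' = (true, true) -> k = (true, true).
  by move=> eq_k; apply: only_tt Dk; rewrite -eq_k.
case: xy xz => -[-> ->] [] [eq_x ->]; move: eq_x sym sym'; rewrite /source /target;
  case: k {Dk} => -[] []; case: k' {Dk'} => -[] [] //= eq_x sym sym' //.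
all: try by case: eq_x => ->.
all: try by have := sym erefl.
all: try by have := sym' erefl.
Qed.

Lemma petal_edges_subset (n : nat) (D : pred (bool * bool)) :
  petal_edges n D \subset petal_edges n predT.
Proof. by apply/subsetP=> e /imsetP[j _ ->]; apply: imset_f; rewrite inE. Qed.

Lemma flower_opt_direct (R : realType) (n : nat) (B : R)
    (T : subgraph (flower R n)) :
  is_opt B T -> (2 * n)%N%:R <= B -> (8 * n)%N%:R <= prize T.
Proof.
case=> _ _ max_T le_B.
(* Witness: the star of all edges [r a], leaving out every [v1] and [v2]. *)
pose V := [set v : flower_vertex n | if v is Some (_, Some _) then false else true].
pose F := petal_edges n (pred1 (true, true)).
have -> : (8 * n)%N%:R = prize (I := flower R n) (V, F).
  rewrite flower_prize_sum /= (eq_bigr (fun=> 8%N)) => [|i _]; last by rewrite !inE.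
  by rewrite sum_nat_const card_ord mulnC.
apply: max_T; last first.
  apply: le_trans le_B; rewrite flower_cost_sum ?petal_edges_subset //=.
  have traceF i k : petal_trace F i k = (k == (true, true)).
    exact: mem_petal_edges.
  rewrite (eq_bigr (fun=> 2%N)) => [|i _]; last by rewrite /petal_cost !traceF.
  by rewrite sum_nat_const card_ord mulnC.
split; last by rewrite inE.
- split; first exact: petal_edges_subset.
  move=> e /imsetP[[i k]]; rewrite inE /= => /eqP-> ->.
  by apply/subsetP=> v /set2P[] ->; rewrite inE.
- apply: connected_to_root => -[[i [b|]]|] //=; rewrite ?inE // => _.
  by apply: connect1; rewrite adj_sym; exact: (mem_petal_edges n (pred1 (true, true)) i (true, true)).
- by apply: petal_edges_acyclic => _ k /eqP.
Qed.

Lemma flower_opt_path (R : realType) (n : nat) (B : R)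
    (T : subgraph (flower R n)) :
  is_opt B T -> (3 * n)%N%:R <= B -> (10 * n)%N%:R <= prize T.
Proof.
case=> _ _ max_T le_B.
(* Witness: the path [r, v1, v2, a] in every petal, a spanning tree. *)
pose F := petal_edges n (predC1 (true, true)).
have -> : (10 * n)%N%:R = prize (I := flower R n) (setT, F).
  rewrite flower_prize_sum /= (eq_bigr (fun=> 10%N)) => [|i _]; last by rewrite !inE.
  by rewrite sum_nat_const card_ord mulnC.
apply: max_T; last first.
  apply: le_trans le_B; rewrite flower_cost_sum ?petal_edges_subset //=.
  have traceF i k : petal_trace F i k = (k != (true, true)).
    exact: mem_petal_edges.
  rewrite (eq_bigr (fun=> 3%N)) => [|i _]; last by rewrite /petal_cost !traceF.
  by rewrite sum_nat_const card_ord mulnC.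
split; last by rewrite inE.
- by split; [exact: petal_edges_subset | move=> e _; apply: subsetT].
- by apply: connected_to_root => v _; apply: flower_path_connect.
- exact: petal_edges_acyclic.
Qed.

(** * Combining the two budgets *)

Lemma flower_tradeoff (R : realType) (n : nat) (pi : seq {set flower R n}) (F : R) :
  incremental pi -> 0 <= F ->
  3%:R * prize (within_budget pi ((2 * n)%N%:R + F)) +
  4%:R * prize (within_budget pi ((3 * n)%N%:R + F)) <= 60%:R * n%:R + 14%:R * F.
Proof.
move=> inc_pi F_ge0.
have B2_ge0 : 0 <= (2 * n)%N%:R + F by rewrite addr_ge0.
have B3_ge0 : 0 <= (3 * n)%N%:R + F by rewrite addr_ge0.
have [tree2 cost2] := within_budget_rooted _ _ inc_pi B2_ge0.
have [tree3 cost3] := within_budget_rooted _ _ inc_pi B3_ge0.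
have le_B : (2 * n)%N%:R + F <= (3 * n)%N%:R + F by rewrite lerD2r ler_nat leq_mul2r orbT.
have /subsetP sub := within_budget_subset pi _ _ le_B.
have [[sub2 _] _ _ _] := tree2; have [[sub3 _] _ _ _] := tree3.
have prize2 := prize_graph_of_petals R n _ sub2; have prize3 := prize_graph_of_petals R n _ sub3.
rewrite flower_cost_sum // in cost2; rewrite flower_cost_sum // in cost3.
set W2 := within_budget pi _ in tree2 cost2 sub sub2 prize2 *.
set W3 := within_budget pi _ in tree3 cost3 sub sub3 prize3 *.
(* [petal_tradeoff] summed over the petals; the cost bounds turn the right side into 10(2n + F) +
   4(3n + F) + 28n = 60n + 14F. *)
have tradeoff : (3 * (\sum_i petal_prize (petal_trace W2.2 i)) +
    4 * (\sum_i petal_prize (petal_trace W3.2 i)) <=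
    10 * (\sum_i petal_cost (petal_trace W2.2 i)) +
    4 * (\sum_i petal_cost (petal_trace W3.2 i)) + n * 28)%N.
  rewrite -[X in (_ + X * 28)%N]card_ord -sum_nat_const !big_distrr -!big_split.
  apply: leq_sum => i _; apply: petal_tradeoff.
  - exact: petal_trace_rooted tree2.
  - exact: petal_trace_rooted tree3.
  - by move=> k; apply: sub.
rewrite -(ler_nat R) in tradeoff.
move: tradeoff; rewrite (natrD _ (3 * _)%N) (natrD _ (_ + _)%N) (natrD _ (10 * _)%N).
rewrite !natrM; rewrite (natrM _ 2%N) in cost2; rewrite (natrM _ 3%N) in cost3.
move: cost2 cost3 prize2 prize3.
set c2 := (\sum_i _)%N%:R; set c3 := (\sum_i _)%N%:R.
set q2 := (\sum_i _)%N%:R; set q3 := (\sum_i _)%N%:R.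
move=> cost2 cost3 prize2 prize3 tradeoff.
lra.
Qed.

Theorem theorem5 (R : realType) (f : R -> R)
    (hf : forall x : R, 0 <= x -> 0 <= f x) :
  (forall mu : R, mu < 17%:R / 16%:R ->
     exists I : instance R,
       ~ exists pi : seq {set I},
           incremental pi /\
           forall B : R, 0 <= B ->
             forall Opt : subgraph I, is_opt B Opt ->
               mu * prize (within_budget pi (B + f (gamma I))) >= prize Opt)
  /\
  (forall (A : algorithm R) (alpha : instance R -> R) (mu : R),
     (forall I : instance R, alpha I = f (gamma I)) ->
     competitive alpha mu A ->
     17%:R / 16%:R <= mu).
Proof.
have lower (mu : R) : mu < 17%:R / 16%:R ->
    exists I : instance R,
      ~ exists pi : seq {set I},
          incremental pi /\ competitive_solution (f (gamma I)) mu pi.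
  (* Every flower with at least one petal has [gamma] equal to 4, so the slack is fixed before [n]
     is chosen. *)
  move=> mu_lt; pose F := f 4%:R.
  have F_ge0 : 0 <= F by apply/hf/ler0n.
  (* Competitiveness would give 64n < (17/16)(60n + 14F), that is n < 59.5F, so n >= 60F suffices;
     the successor guarantees a petal. *)
  pose n := (Num.bound (60%:R * F)).+1.
  have n_large : 60%:R * F <= n%:R.
    apply: ltW; apply: lt_le_trans (archi_boundP _) _; first by rewrite mulr_ge0.
    by rewrite ler_nat.
  have n_ge1 : 1 <= n%:R :> R by rewrite ler1n.
  exists (flower R n); rewrite flower_gamma -/F => -[pi [inc_pi comp]].
  have upper := flower_tradeoff R n pi F inc_pi F_ge0.
  have low m : prize (within_budget pi ((m * n)%N%:R + F)) >= 0 :> R.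
    by apply: sumr_ge0 => v _; apply: vprize_ge0.
  have [T2 opt2] := opt_exists (flower R n) (ler0n R (2 * n)).
  have [T3 opt3] := opt_exists (flower R n) (ler0n R (3 * n)).
  have ge2 := le_trans (flower_opt_direct R n _ _ opt2 (lexx _)) (comp _ (ler0n R _) _ opt2).
  have ge3 := le_trans (flower_opt_path R n _ _ opt3 (lexx _)) (comp _ (ler0n R _) _ opt3).
  have := low 2%N; have := low 3%N; move: ge2 ge3 upper.
  rewrite (natrM _ 8%N) (natrM _ 10%N).
  set p2 := prize _; set p3 := prize _ => ge2 ge3 upper p3_ge0 p2_ge0.
  have le2 : mu * p2 <= 17%:R / 16%:R * p2 by rewrite ler_wpM2r // ltW.
  (* Strictness requires [p3] to be positive: [p3 = 0] would contradict [ge3], since 10n > 0. *)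
  have lt3 : mu * p3 < 17%:R / 16%:R * p3.
    rewrite ltr_pM2r // lt_neqAle p3_ge0 andbT eq_sym; apply/eqP=> p3_0.
    by move: ge3; rewrite p3_0; lra.
  lra.
split=> [mu /lower[I no_pi]|A alpha mu alphaE comp]; first by exists I.
rewrite leNgt; apply/negP=> /lower[I]; apply.
by exists (sval (A I)); split; [exact: svalP | rewrite -alphaE; exact: comp].
Qed.
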